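(* Let $\mathcal{V}$ be a variety of non-associative algebras over a field $\mathbb{K}$, and let $A$ and $C$ be algebras in $\mathcal{V}$. Then the coproduct of $A$ and $C$ in $\mathcal{V}$ exists, and it is obtained as the reflection $L(A+C)$ into $\mathcal{V}$ of the coproduct $A+C$ of $A$ and $C$ in $\mathsf{Alg}_{\mathbb{K}}$.
   Context: Fix a field $\mathbb{K}$. A (non-associative) algebra over $\mathbb{K}$ is a $\mathbb{K}$-vector space $A$ with a bilinear multiplication $A\times A\to A$ (no associativity, unit, etc. is assumed). Morphisms are linear maps preserving the multiplication; the resulting category is $\mathsf{Alg}_{\mathbb{K}}$. Let $X=\{x_1,x_2,\dots\}$ be a countable set of variables. For a set $S$, let $\mathbb{K}[M(S)]$ be the free non-associative $\mathbb{K}$-algebra on $S$ (the vector space with basis the free magma $M(S)$ on $S$, with bilinearly extended multiplication); its elements are called polynomials. A polynomial $\psi(x_1,\dots,x_n)\in\mathbb{K}[M(X)]$ is an identity of $A$ if $\psi(a_1,\dots,a_n)=0$ for all $a_1,\dots,a_n\in A$. A variety of non-associative algebras $\mathcal{V}$ is the full subcategory of $\mathsf{Alg}_{\mathbb{K}}$ consisting of all algebras satisfying every identity in some given subset $I$ of $\mathbb{K}[M(X)]$. The inclusion $\mathcal{V}\to\mathsf{Alg}_{\mathbb{K}}$ has a left adjoint $L$ (the reflection), with $L(A)=A/I(A)$, where $I(A)$ is the ideal of $A$ generated by all $\psi(a_1,\dots,a_n)$ with $\psi\in I$ and $a_i\in A$; its unit $\eta_A\colon A\to L(A)$ is the quotient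 map. The coproduct $A+C$ of two algebras in $\mathsf{Alg}_{\mathbb{K}}$ exists: it is the quotient of $\mathbb{K}[M(A\,\dot\cup\,C)]$ (free algebra on the disjoint union of the underlying sets) by the ideal generated by $R(A)\cup R(C)$, where $R(B)$ is the kernel of the morphism $\mathbb{K}[M(B)]\to B$ sending each $b\in B$ to itself. Its coproduct injections $\iota_A$, $\iota_C$ are induced by the inclusions of $A$ and $C$ into $A\,\dot\cup\,C$. The coproduct injections of $L(A+C)$ are the composites $\eta_{A+C}\circ\iota_A$ and $\eta_{A+C}\circ\iota_C$. *)

(* Defs.v *)
From HB Require Import structures.
From mathcomp Require Import all_boot all_algebra.
From mathcomp Require Import generic_quotient ring_quotient.
From mathcomp Require Import finmap.
From mathcomp.multinomials Require Import monalg.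
From mathcomp Require Import boolp classical_sets.

Set Implicit Arguments.
Unset Strict Implicit.
Unset Printing Implicit Defensive.

Import GRing.Theory.
Local Open Scope ring_scope.
Local Open Scope quotient_scope.
Local Open Scope classical_set_scope.

Declare Scope nonassoc_scope.
Delimit Scope nonassoc_scope with NA.
Local Open Scope nonassoc_scope.

(* Algebras carry no associativity law and no unit, so they are not covered by
   the ring-like structures of MathComp. *)
HB.mixin Record Lmodule_isNonAssocAlgebra (K : fieldType) A
    of GRing.Lmodule K A := {
  namul : A -> A -> A;
  namul_linearl : forall (y : A) (a : K) (x x' : A),
    namul (a *: x + x') y = a *: namul x y + namul x' y;
  namul_linearr : forall (x : A) (a : K) (y y' : A),
    namul x (a *: y + y') = a *: namul x y + namul x y'
}.

#[short(type="naAlgType")]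
HB.structure Definition NonAssocAlgebra (K : fieldType) :=
  {A of GRing.Lmodule K A & Lmodule_isNonAssocAlgebra K A}.

Notation "x ** y" := (namul x y)
  (at level 40, left associativity) : nonassoc_scope.

Section NonAssocTheory.
Variables (K : fieldType) (A : naAlgType K).
Implicit Types x y z : A.

Lemma namulDl y x x' : (x + x') ** y = x ** y + x' ** y.
Proof. by have := namul_linearl y 1 x x'; rewrite !scale1r. Qed.

Lemma namulDr x y y' : x ** (y + y') = x ** y + x ** y'.
Proof. by have := namul_linearr x 1 y y'; rewrite !scale1r. Qed.

Lemma namul0l y : 0 ** y = 0.
Proof. by apply: (addIr (0 ** y)); rewrite -namulDl !add0r. Qed.

Lemma namul0r x : x ** 0 = 0.
Proof. by apply: (addIr (x ** 0)); rewrite -namulDr !add0r. Qed.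

Lemma namulNl y x : (- x) ** y = - (x ** y).
Proof. by apply/eqP; rewrite -addr_eq0 -namulDl addNr namul0l. Qed.

Lemma namulNr x y : x ** (- y) = - (x ** y).
Proof. by apply/eqP; rewrite -addr_eq0 -namulDr addNr namul0r. Qed.

End NonAssocTheory.

Definition is_namorphism (K : fieldType) (A B : naAlgType K) (f : A -> B) :=
  linear f /\ {morph f : x y / x ** y}.

Inductive magma (S : Type) : Type :=
| MVar of S
| MMul of magma S & magma S.

Section MagmaChoice.
Variable S : choiceType.

Fixpoint magma_encode (m : magma S) : GenTree.tree S :=
  match m with
  | MVar s => GenTree.Leaf s
  | MMul u v => GenTree.Node 0 [:: magma_encode u; magma_encode v]
  end.

Fixpoint magma_decode (t : GenTree.tree S) : option (magma S) :=
  match t with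
  | GenTree.Leaf s => Some (MVar s)
  | GenTree.Node _ [:: t; t'] =>
      if magma_decode t is Some u then
        if magma_decode t' is Some v then Some (MMul u v) else None
      else None
  | _ => None
  end.

Lemma magma_encodeK : pcancel magma_encode magma_decode.
Proof. by elim=> //= u -> v ->. Qed.

HB.instance Definition _ := Choice.copy (magma S) (pcan_type magma_encodeK).

End MagmaChoice.

Section FreeAlgebra.
Variables (K : fieldType) (S : choiceType).

Definition free_alg : Type := {malg K[magma S]}.

HB.instance Definition _ := GRing.Lmodule.on free_alg.

Definition free_mul (p q : free_alg) : free_alg :=
  \sum_(u <- msupp p) \sum_(v <- msupp q) << p@_u * q@_v *g MMul u v >>.

Lemma free_mulEw (D E : {fset magma S}) (p q : free_alg) :
  (msupp p `<=` D)%fset -> (msupp q `<=` E)%fset ->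
  free_mul p q = \sum_(u <- D) \sum_(v <- E) << p@_u * q@_v *g MMul u v >>.
Proof.
move=> pD qE; rewrite /free_mul.
rewrite (big_fset_incl _ pD) /=; last first.
  by move=> u _ /mcoeff_outdom up; rewrite big1 // => v _;
    rewrite up mul0r monalgU0.
apply: eq_bigr => u _; apply: (big_fset_incl _ qE) => v _ /mcoeff_outdom vq.
by rewrite vq mulr0 monalgU0.
Qed.

Lemma free_mul_linearl (q : free_alg) (a : K) (p p' : free_alg) :
  free_mul (a *: p + p') q = a *: free_mul p q + free_mul p' q.
Proof.
pose D := (msupp (a *: p + p') `|` (msupp p `|` msupp p'))%fset.
have sD : (msupp (a *: p + p') `<=` D)%fset by apply: fsubsetUl.
have pD : (msupp p `<=` D)%fset.
  by apply: fsubset_trans (fsubsetUr _ _); apply: fsubsetUl.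
have p'D : (msupp p' `<=` D)%fset.
  by apply: fsubset_trans (fsubsetUr _ _); apply: fsubsetUr.
rewrite !(free_mulEw (D := D) (E := msupp q)) // scaler_sumr -big_split /=.
apply: eq_bigr => u _; rewrite scaler_sumr -big_split /=.
apply: eq_bigr => v _; apply/malgP => k.
by rewrite !(mcoeffD, mcoeffZ, mcoeffU) mulrDl mulrnDl -mulrA mulrnAr.
Qed.

Lemma free_mul_linearr (p : free_alg) (a : K) (q q' : free_alg) :
  free_mul p (a *: q + q') = a *: free_mul p q + free_mul p q'.
Proof.
pose D := (msupp (a *: q + q') `|` (msupp q `|` msupp q'))%fset.
have sD : (msupp (a *: q + q') `<=` D)%fset by apply: fsubsetUl.
have qD : (msupp q `<=` D)%fset.
  by apply: fsubset_trans (fsubsetUr _ _); apply: fsubsetUl.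
have q'D : (msupp q' `<=` D)%fset.
  by apply: fsubset_trans (fsubsetUr _ _); apply: fsubsetUr.
rewrite !(free_mulEw (D := msupp p) (E := D)) // scaler_sumr -big_split /=.
apply: eq_bigr => u _; rewrite scaler_sumr -big_split /=.
apply: eq_bigr => v _; apply/malgP => k.
by rewrite !(mcoeffD, mcoeffZ, mcoeffU) mulrDr mulrnDl mulrCA mulrnAr.
Qed.

HB.instance Definition _ := Lmodule_isNonAssocAlgebra.Build K free_alg
  free_mul_linearl free_mul_linearr.

Section Lift.
Variables (A : naAlgType K) (f : S -> A).

Fixpoint magma_eval (m : magma S) : A :=
  match m with
  | MVar s => f s
  | MMul u v => magma_eval u ** magma_eval v
  end.

Definition free_lift (p : free_alg) : A :=
  \sum_(m <- msupp p) p@_m *: magma_eval m.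

End Lift.

End FreeAlgebra.

(* Locked, since comparing distinct monomials by conversion unfolds their
   finitely supported coefficient functions. *)
HB.lock Definition free_gen (K : fieldType) (S : choiceType) (s : S) :
  free_alg K S := << MVar s >>.

Arguments free_gen K {S} s.

Section Quotient.
Variables (K : fieldType) (A : naAlgType K).

Definition is_ideal (J : set A) : Prop :=
  [/\ J 0,
      forall (a : K) x y, J x -> J y -> J (a *: x + y) &
      forall x y, J y -> J (x ** y) /\ J (y ** x)].

Definition ideal_gen (G : set A) : set A := smallest is_ideal G.

Lemma ideal_gen_ideal G : is_ideal (ideal_gen G).
Proof.
split.
- by move=> J [[]].
- move=> a x y Ix Iy J GJ; have [[_ JD _] _] := GJ.
  by apply: JD; [apply: Ix | apply: Iy].
- move=> x y Iy; split=> J GJ; have [[_ _ JM] _] := GJ.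
    by have [] := JM x y (Iy J GJ).
  by have [] := JM x y (Iy J GJ).
Qed.

Definition ideal_pred (G : set A) (x : A) : bool := `[< ideal_gen G x >].

Lemma ideal_pred_zmod G : zmod_closed (ideal_pred G).
Proof.
have [I0 ID _] := ideal_gen_ideal G; split; first exact/asboolP.
move=> x y /asboolP Ix /asboolP Iy; apply/asboolP.
by rewrite addrC -scaleN1r; apply: ID.
Qed.

HB.instance Definition _ G :=
  GRing.isZmodClosed.Build A (ideal_pred G) (ideal_pred_zmod G).

Definition ideal_zmod (G : set A) : zmodClosed A :=
  GRing.ZmodClosed.clone A (ideal_pred G) _.

(* The quotient of A by the ideal generated by G. *)
Definition quot_alg (G : set A) : Type := Quotient.quot (ideal_zmod G).

Section Structure.
Variable G : set A.
Local Notation Q := (quot_alg G).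

HB.instance Definition _ := GRing.Zmodule.on Q.

Definition quot_pi (x : A) : Q := \pi_(Quotient.quot (ideal_zmod G)) x.

Lemma quot_piP x y : quot_pi x = quot_pi y <-> ideal_gen G (x - y).
Proof.
split=> [/eqP|Ixy]; first by rewrite -Quotient.idealrBE => /asboolP.
by apply/eqP; rewrite -Quotient.idealrBE; apply/asboolP.
Qed.

Definition quot_repr (x : Q) : A := repr (x : Quotient.quot (ideal_zmod G)).

Lemma quot_reprK : cancel quot_repr quot_pi.
Proof. exact: reprK. Qed.

Lemma quot_piD x y : quot_pi (x + y) = quot_pi x + quot_pi y.
Proof. exact: (raddfD (\pi_(Quotient.quot (ideal_zmod G)))). Qed.

Definition quot_scale (a : K) (x : Q) : Q := quot_pi (a *: quot_repr x).

Definition quot_mul (x y : Q) : Q := quot_pi (quot_repr x ** quot_repr y).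

Lemma quot_piZ a x : quot_scale a (quot_pi x) = quot_pi (a *: x).
Proof.
have [I0 ID _] := ideal_gen_ideal G.
apply/quot_piP; rewrite -scalerBr -[_ *: _]addr0; apply: ID => //.
by apply/quot_piP; rewrite quot_reprK.
Qed.

Lemma quot_piM x y : quot_mul (quot_pi x) (quot_pi y) = quot_pi (x ** y).
Proof.
have [I0 ID IM] := ideal_gen_ideal G.
set x' := quot_repr (quot_pi x); set y' := quot_repr (quot_pi y).
have Ix : ideal_gen G (x' - x) by apply/quot_piP; rewrite quot_reprK.
have Iy : ideal_gen G (y' - y) by apply/quot_piP; rewrite quot_reprK.
apply/quot_piP; rewrite -/x' -/y'.
have -> : x' ** y' - x ** y = 1 *: ((x' - x) ** y') + x ** (y' - y).
  by rewrite scale1r namulDl namulDr namulNl namulNr addrA subrK.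
by apply: ID; [have [] := IM y' _ Ix | have [] := IM x _ Iy].
Qed.

Lemma quot_scalerA a b x : quot_scale a (quot_scale b x) = quot_scale (a * b) x.
Proof. by rewrite -[x]quot_reprK !quot_piZ scalerA. Qed.

Lemma quot_scale1r : left_id 1 quot_scale.
Proof. by move=> x; rewrite -[x]quot_reprK quot_piZ scale1r. Qed.

Lemma quot_scalerDr : right_distributive quot_scale +%R.
Proof.
move=> a x y; rewrite -[x]quot_reprK -[y]quot_reprK.
by rewrite -quot_piD !quot_piZ -quot_piD scalerDr.
Qed.

Lemma quot_scalerDl x : {morph quot_scale^~ x : a b / a + b}.
Proof. by move=> a b; rewrite -[x]quot_reprK !quot_piZ scalerDl quot_piD. Qed.

HB.instance Definition _ := GRing.Zmodule_isLmodule.Build K Q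
  quot_scalerA quot_scale1r quot_scalerDr quot_scalerDl.

Lemma quot_mul_linearl (y : Q) (a : K) (x x' : Q) :
  quot_mul (a *: x + x') y = a *: quot_mul x y + quot_mul x' y.
Proof.
rewrite -[x]quot_reprK -[x']quot_reprK -[y]quot_reprK /GRing.scale /=.
by rewrite quot_piZ -quot_piD !quot_piM quot_piZ -quot_piD namul_linearl.
Qed.

Lemma quot_mul_linearr (x : Q) (a : K) (y y' : Q) :
  quot_mul x (a *: y + y') = a *: quot_mul x y + quot_mul x y'.
Proof.
rewrite -[x]quot_reprK -[y]quot_reprK -[y']quot_reprK /GRing.scale /=.
by rewrite quot_piZ -quot_piD !quot_piM quot_piZ -quot_piD namul_linearr.
Qed.

HB.instance Definition _ := Lmodule_isNonAssocAlgebra.Build K Q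
  quot_mul_linearl quot_mul_linearr.

End Structure.

End Quotient.

(* Polynomials in the variables x_0, x_1, ... *)
Definition na_polynomial (K : fieldType) : Type := free_alg K nat.

(* A value is assigned to each of the countably many variables; only those
   occurring in psi matter. *)
Definition is_identity (K : fieldType) (A : naAlgType K)
    (psi : na_polynomial K) : Prop :=
  forall a : nat -> A, free_lift a psi = 0.

(* As a full subcategory, a variety is determined by its class of objects. *)
Definition variety (K : fieldType) (I : set (na_polynomial K))
    (A : naAlgType K) : Prop :=
  forall psi, I psi -> is_identity A psi.

Section Reflection.
Variables (K : fieldType) (I : set (na_polynomial K)) (A : naAlgType K).

Definition identity_values : set A :=
  [set x | exists2 psi, I psi & exists a : nat -> A, x = free_lift a psi].

Definition reflection : naAlgType K := quot_alg identity_values.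

Definition reflection_unit : A -> reflection := @quot_pi K A identity_values.

End Reflection.

Arguments reflection_unit {K} I A _.

Section Coproduct.
Variables (K : fieldType) (A C : naAlgType K).

(* R(B), the kernel of the canonical morphism K[M(B)] -> B *)
Definition canonical_relations (B : naAlgType K) : set (free_alg K B) :=
  [set p | free_lift (fun b : B => b) p = 0].

(* The two free_lift maps are the inclusions of K[M(A)] and K[M(C)] into the
   free algebra on the disjoint union of A and C. *)
Definition coproduct_relations : set (free_alg K (A + C)%type) :=
  (free_lift (fun a : A => free_gen K (inl a : (A + C)%type))
     @` @canonical_relations A) `|`
  (free_lift (fun c : C => free_gen K (inr c : (A + C)%type))
     @` @canonical_relations C).

Definition coproduct : naAlgType K := quot_alg coproduct_relations.

Definition coproduct_inl (a : A) : coproduct :=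
  quot_pi coproduct_relations (free_gen K (inl a : (A + C)%type)).

Definition coproduct_inr (c : C) : coproduct :=
  quot_pi coproduct_relations (free_gen K (inr c : (A + C)%type)).

End Coproduct.

Arguments coproduct_inl {K} A C _.
Arguments coproduct_inr {K} A C _.

(* Coproducts in the full subcategory with class of objects V. *)
Definition is_coproduct (K : fieldType) (V : naAlgType K -> Prop)
    (A C P : naAlgType K) (i : A -> P) (j : C -> P) : Prop :=
  [/\ V P, is_namorphism i, is_namorphism j &
      forall (B : naAlgType K) (f : A -> B) (g : C -> B),
        V B -> is_namorphism f -> is_namorphism g ->
        exists! h : P -> B,
          [/\ is_namorphism h, h \o i = f & h \o j = g]].

Definition has_coproduct (K : fieldType) (V : naAlgType K -> Prop)
    (A C : naAlgType K) : Prop :=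
  exists (P : naAlgType K) (i : A -> P) (j : C -> P), is_coproduct V i j.

(* Main.v *)
Require Import Defs.
From mathcomp Require Import all_boot all_algebra classical_sets.
From mathcomp Require Import finmap boolp.
From mathcomp.multinomials Require Import monalg.

(** The coproduct and the reflection are both quotients, the former of a free
    algebra, so maps out of them are controlled by two facts: a morphism commutes with the evaluation of
    polynomials, and a morphism killing a set [G] factors uniquely through the
    quotient by the ideal that [G] generates. The universal property of
    [L(A + C)] is then that of [A + C] followed by that of the reflection. *)

Set Implicit Arguments.
Unset Strict Implicit.
Unset Printing Implicit Defensive.

Import GRing.Theory.
Local Open Scope ring_scope.
Local Open Scope classical_set_scope.
Local Open Scope nonassoc_scope.

(** * Elementary properties of morphisms *)

Section Morphisms.
Variable K : fieldType.
Implicit Types A B C : naAlgType K.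

Lemma namorphismZD A B (f : A -> B) a x y :
  is_namorphism f -> f (a *: x + y) = a *: f x + f y.
Proof. by case=> lf _; apply: lf. Qed.

Lemma namorphismM A B (f : A -> B) x y :
  is_namorphism f -> f (x ** y) = f x ** f y.
Proof. by case=> _ mf; apply: mf. Qed.

Lemma namorphismD A B (f : A -> B) x y :
  is_namorphism f -> f (x + y) = f x + f y.
Proof. by move=> hf; rewrite -[x]scale1r namorphismZD // !scale1r. Qed.

Lemma namorphism0 A B (f : A -> B) : is_namorphism f -> f 0 = 0.
Proof. by move=> hf; apply: (addIr (f 0)); rewrite -namorphismD // !add0r. Qed.

Lemma namorphismZ A B (f : A -> B) a x :
  is_namorphism f -> f (a *: x) = a *: f x.
Proof.
by move=> hf; rewrite -[a *: x]addr0 namorphismZD // (namorphism0 hf) addr0.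
Qed.

Lemma namorphismB A B (f : A -> B) x y :
  is_namorphism f -> f (x - y) = f x - f y.
Proof.
by move=> hf; rewrite namorphismD // -scaleN1r namorphismZ // scaleN1r.
Qed.

Lemma namorphism_sum A B (f : A -> B) (T : Type) (r : seq T) (F : T -> A) :
  is_namorphism f -> f (\sum_(i <- r) F i) = \sum_(i <- r) f (F i).
Proof.
move=> hf; apply: (big_morph f _ (namorphism0 hf)) => x y.
exact: namorphismD.
Qed.

Lemma namorphism_comp A B C (g : B -> C) (f : A -> B) :
  is_namorphism g -> is_namorphism f -> is_namorphism (g \o f).
Proof.
by move=> hg hf; split=> [a x y|x y] /=;
  rewrite ?(namorphismZD _ _ _ hf) ?(namorphismM _ _ hf)
          ?(namorphismZD _ _ _ hg) ?(namorphismM _ _ hg).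
Qed.

End Morphisms.

(** * Evaluation of polynomials and the universal property of the free algebra *)

Section FreeLift.
Variables (K : fieldType) (S : choiceType).

Section Morphism.
Variables (A : naAlgType K) (f : S -> A).

(** Supports change under addition and scaling; summing over a common finite superset lets
    polynomials be compared term by term. *)
Lemma free_liftEw (D : {fset magma S}) (p : free_alg K S) :
  (msupp p `<=` D)%fset ->
  free_lift f p = \sum_(m <- D) p@_m *: magma_eval f m.
Proof.
move=> pD; apply: (big_fset_incl _ pD) => m _ /mcoeff_outdom ->.
by rewrite scale0r.
Qed.

Lemma free_lift_linear : linear (free_lift f : free_alg K S -> A).
Proof.
move=> a p q.
pose D := (msupp (a *: p + q) `|` (msupp p `|` msupp q))%fset.
have sD : (msupp (a *: p + q) `<=` D)%fset by apply: fsubsetUl.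
have pD : (msupp p `<=` D)%fset.
  by apply: fsubset_trans (fsubsetUr _ _); apply: fsubsetUl.
have qD : (msupp q `<=` D)%fset.
  by apply: fsubset_trans (fsubsetUr _ _); apply: fsubsetUr.
rewrite !(free_liftEw (D := D)) // scaler_sumr -big_split /=.
by apply: eq_bigr => m _; rewrite mcoeffD mcoeffZ scalerDl scalerA.
Qed.

Lemma free_lift_sum (T : Type) (r : seq T) (F : T -> free_alg K S) :
  free_lift f (\sum_(i <- r) F i) = \sum_(i <- r) free_lift f (F i).
Proof.
apply: (big_morph (free_lift f : free_alg K S -> A)).
  by move=> p q; have := free_lift_linear 1 p q; rewrite !scale1r.
by rewrite /free_lift msupp0 big_seq_fset0.
Qed.

Lemma free_liftU (c : K) (m : magma S) :
  free_lift f (<< c *g m >> : free_alg K S) = c *: magma_eval f m.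
Proof.
by rewrite (free_liftEw (D := [fset m]%fset)) ?msuppU_le // big_seq_fset1
           mcoeffUU.
Qed.

Lemma namul_suml (T : Type) (r : seq T) (F : T -> A) (y : A) :
  (\sum_(i <- r) F i) ** y = \sum_(i <- r) (F i ** y).
Proof.
by apply: (big_morph (namul^~ y)) => [x x'|]; [apply: namulDl | apply: namul0l].
Qed.

Lemma namul_sumr (T : Type) (r : seq T) (F : T -> A) (x : A) :
  x ** (\sum_(i <- r) F i) = \sum_(i <- r) (x ** F i).
Proof.
by apply: (big_morph (namul x)) => [y y'|]; [apply: namulDr | apply: namul0r].
Qed.

Lemma namulZl (c : K) (x y : A) : (c *: x) ** y = c *: (x ** y).
Proof. by have := namul_linearl y c x 0; rewrite namul0l !addr0. Qed.

Lemma namulZr (c : K) (x y : A) : x ** (c *: y) = c *: (x ** y).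
Proof. by have := namul_linearr x c y 0; rewrite namul0r !addr0. Qed.

Lemma free_lift_namorphism : is_namorphism (free_lift f : free_alg K S -> A).
Proof.
split=> [|p q]; first exact: free_lift_linear.
(* [p ** q] is by definition a double sum over the two supports, so both sides are compared one pair
   of monomials at a time. *)
rewrite free_lift_sum namul_suml; apply: eq_bigr => u _.
rewrite free_lift_sum namul_sumr; apply: eq_bigr => v _.
by rewrite free_liftU namulZl namulZr scalerA.
Qed.

Lemma free_lift_gen (s : S) : free_lift f (free_gen K s) = f s.
Proof. by rewrite free_gen.unlock free_liftU scale1r. Qed.

End Morphism.

Lemma namorphism_free_lift (A B : naAlgType K) (h : A -> B) (f : S -> A)
    (p : free_alg K S) :
  is_namorphism h -> h (free_lift f p) = free_lift (h \o f) p.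
Proof.
move=> hh; rewrite namorphism_sum //; apply: eq_bigr => m _.
rewrite namorphismZ //; congr (_ *: _).
by elim: m => //= u IHu v IHv; rewrite namorphismM // IHu IHv.
Qed.

(** Every polynomial is thus built from the generators, which gives the uniqueness half of the
    universal property. *)
Lemma free_lift_free_gen (p : free_alg K S) :
  free_lift (@free_gen K S) p = p.
Proof.
rewrite [RHS](monalgE p); apply: eq_bigr => m _.
suff -> : magma_eval (@free_gen K S) m = << m >> :> free_alg K S.
  by apply/malgP => k; rewrite mcoeffZ 2!mcoeffU mulrnAr mulr1.
elim: m => [s|u IHu v IHv] /=; first by rewrite free_gen.unlock.
(* The product of two monomials is exposed as [free_mul] and expanded over singletons containing
   their supports. *)
rewrite IHu IHv -[LHS]/(free_mul _ _).
rewrite (free_mulEw (D := [fset u]%fset) (E := [fset v]%fset)) ?msuppU_le //.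
by rewrite 2!big_seq_fset1 2!mcoeffUU mulr1.
Qed.

Lemma free_alg_ext (B : naAlgType K) (h h' : free_alg K S -> B) :
  is_namorphism h -> is_namorphism h' ->
  h \o @free_gen K S = h' \o @free_gen K S -> h = h'.
Proof.
move=> hh hh' e; apply/funext => p.
by rewrite -[p]free_lift_free_gen !namorphism_free_lift // e.
Qed.

End FreeLift.

(** * Universal property of the quotient by a generated ideal *)

Section QuotientUP.
Variables (K : fieldType) (A : naAlgType K) (G : set A).

Lemma quot_pi_namorphism : is_namorphism (quot_pi G : A -> quot_alg G).
Proof.
split=> [a x y|x y]; last by rewrite -quot_piM.
by rewrite quot_piD -quot_piZ.
Qed.

Lemma quot_pi_eq0 x : G x -> quot_pi G x = 0.
Proof.
move=> Gx; rewrite -(namorphism0 quot_pi_namorphism); apply/quot_piP.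
by rewrite subr0; apply: sub_gen_smallest.
Qed.

Lemma quot_alg_ext (B : Type) (h h' : quot_alg G -> B) :
  h \o quot_pi G = h' \o quot_pi G -> h = h'.
Proof.
move=> e; apply/funext => x; rewrite -[x]quot_reprK.
exact: (congr1 (@^~ (quot_repr x)) e).
Qed.

Lemma kernel_ideal (B : naAlgType K) (h : A -> B) :
  is_namorphism h -> is_ideal [set x | h x = 0].
Proof.
move=> hh; split=> /= [|a x y hx hy|x y hy]; first exact: namorphism0.
  by rewrite namorphismZD // hx hy scaler0 addr0.
by rewrite !namorphismM // hy namul0l namul0r.
Qed.

(** The factorization is [h] on chosen representatives. The choice is harmless: two representatives
    differ by an element of the ideal generated by [G], and the kernel of [h] is an ideal containing
    [G]. *)
Lemma quot_alg_lift (B : naAlgType K) (h : A -> B) :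
  is_namorphism h -> (forall x, G x -> h x = 0) ->
  exists2 k : quot_alg G -> B, is_namorphism k & k \o quot_pi G = h.
Proof.
move=> hh hG; pose k (x : quot_alg G) := h (quot_repr x).
have kE x : k (quot_pi G x) = h x.
  apply/eqP; rewrite -subr_eq0 /k -namorphismB //; apply/eqP.
  have /quot_piP Gx : quot_pi G (quot_repr (quot_pi G x)) = quot_pi G x.
    exact: quot_reprK.
  by apply: (Gx [set x | h x = 0]); split; [apply: kernel_ideal | apply: hG].
exists k; last exact/funext.
split=> [a x y|x y]; rewrite -[x]quot_reprK -[y]quot_reprK.
  by rewrite -(namorphismZD _ _ _ quot_pi_namorphism) !kE namorphismZD.
by rewrite -(namorphismM _ _ quot_pi_namorphism) !kE namorphismM.
Qed.

End QuotientUP.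

(** * The coproduct in the category of all algebras *)

Section CoproductUP.
Variables (K : fieldType) (A C : naAlgType K).

(* [gen (a *: x + y) - (a *: gen x + gen y)] and [gen (x ** y) - gen x ** gen y]
   are relations of [B]. *)
Lemma canonical_relations_namorphism (B P : naAlgType K) (i : B -> P) :
  (forall p, canonical_relations p -> free_lift i p = 0) -> is_namorphism i.
Proof.
move=> hi; have li := free_lift_namorphism i.
have l1 := free_lift_namorphism (fun b : B => b).
split=> [a x y|x y]; apply/eqP; rewrite -subr_eq0; apply/eqP.
  rewrite -[i x](free_lift_gen i) -[i y](free_lift_gen i).
  rewrite -[i (_ + _)](free_lift_gen i).
  rewrite -(namorphismZD _ _ _ li) -namorphismB //; apply: hi.
  rewrite /canonical_relations /= (namorphismB _ _ l1) (namorphismZD _ _ _ l1).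
  by rewrite !free_lift_gen subrr.
rewrite -[i x](free_lift_gen i) -[i y](free_lift_gen i).
rewrite -[i (_ ** _)](free_lift_gen i).
rewrite -(namorphismM _ _ li) -namorphismB //; apply: hi.
rewrite /canonical_relations /= (namorphismB _ _ l1) (namorphismM _ _ l1).
by rewrite !free_lift_gen subrr.
Qed.

Lemma coproduct_inl_namorphism : is_namorphism (coproduct_inl A C).
Proof.
apply: canonical_relations_namorphism => p Rp.
(* The value of [p] at [coproduct_inl] is the class of the image of [p] in the free algebra on the
   disjoint union, which is one of the relations. *)
rewrite -(namorphism_free_lift _ _ (quot_pi_namorphism _)).
by apply: quot_pi_eq0; left; exists p.
Qed.

Lemma coproduct_inr_namorphism : is_namorphism (coproduct_inr A C).
Proof.
apply: canonical_relations_namorphism => p Rp.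
rewrite -(namorphism_free_lift _ _ (quot_pi_namorphism _)).
by apply: quot_pi_eq0; right; exists p.
Qed.

(** Evaluating at [f] amounts to evaluating in [B] and then applying [f]. *)
Lemma canonical_relations_lift (B D : naAlgType K) (f : B -> D) p :
  is_namorphism f -> canonical_relations p -> free_lift f p = 0.
Proof.
move=> hf Rp; rewrite -[f]/(f \o (fun b => b)) -namorphism_free_lift //.
by rewrite Rp namorphism0.
Qed.

Lemma coproduct_is_coproduct :
  is_coproduct (fun=> True) (coproduct_inl A C) (coproduct_inr A C).
Proof.
split=> // [||B f g _ hf hg]; [exact: coproduct_inl_namorphism
  | exact: coproduct_inr_namorphism |].
pose fg (s : (A + C)%type) := match s with inl a => f a | inr c => g c end.
have lfg := free_lift_namorphism fg.
have [|h hh hE] := quot_alg_lift (G := @coproduct_relations K A C) lfg.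
  (* On the image of a relation [p] of [A] (resp. [C]), the lift of [fg] is the evaluation of [p] at
     [f] (resp. [g]). *)
  move=> _ [] [p Rp <-]; rewrite (namorphism_free_lift _ _ lfg).
    rewrite (_ : _ \o _ = f) ?(canonical_relations_lift hf) //.
    by apply/funext => a; rewrite /= free_lift_gen.
  rewrite (_ : _ \o _ = g) ?(canonical_relations_lift hg) //.
  by apply/funext => c; rewrite /= free_lift_gen.
have hgen s : h (quot_pi _ (free_gen K s)) = fg s.
  by rewrite -(free_lift_gen fg) -hE.
exists h; split; first by split=> //; apply/funext => x; apply: hgen.
move=> h' [hh' h'f h'g]; apply: quot_alg_ext; apply: free_alg_ext.
- exact: namorphism_comp hh (quot_pi_namorphism _).
- exact: namorphism_comp hh' (quot_pi_namorphism _).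
apply/funext => s; rewrite /= hgen.
by case: s => [a|c]; rewrite /fg -?h'f -?h'g.
Qed.

End CoproductUP.

(** * The reflection into a variety *)

Section ReflectionUP.
Variables (K : fieldType) (I : set (na_polynomial K)) (A : naAlgType K).

Lemma reflection_variety : variety I (reflection I A).
Proof.
move=> psi Ipsi a.
(* Lifting the assignment to representatives makes the value of [psi] at [a] the class of its value
   at [b], an element of [identity_values]. *)
pose b := fun n => quot_repr (a n).
have -> : a = reflection_unit I A \o b.
  by apply/funext => n /=; rewrite /reflection_unit quot_reprK.
rewrite -(namorphism_free_lift _ _ (quot_pi_namorphism _)).
by apply: quot_pi_eq0; exists psi => //; exists b.
Qed.

Lemma reflection_unit_namorphism : is_namorphism (reflection_unit I A).
Proof. exact: quot_pi_namorphism. Qed.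

Lemma reflection_lift (B : naAlgType K) (h : A -> B) :
  variety I B -> is_namorphism h ->
  exists2 k : reflection I A -> B,
    is_namorphism k & k \o reflection_unit I A = h.
Proof.
move=> VB hh; apply: quot_alg_lift => // _ [psi Ipsi [a ->]].
by rewrite namorphism_free_lift //; apply: VB.
Qed.

End ReflectionUP.

(** An instance of left adjoints preserving coproducts, so [P] may be any coproduct in the category
    of all algebras. *)
Lemma reflection_is_coproduct (K : fieldType) (I : set (na_polynomial K))
    (A C P : naAlgType K) (i : A -> P) (j : C -> P) :
  is_coproduct (fun=> True) i j ->
  is_coproduct (variety I) (P := reflection I P)
    (reflection_unit I P \o i) (reflection_unit I P \o j).
Proof.
move=> [_ hi hj uP]; have heta := reflection_unit_namorphism I P.
split; [exact: reflection_variety | exact: namorphism_comp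
  | exact: namorphism_comp |].
move=> B f g VB hf hg; have [h [[hh hf' hg'] hU]] := uP B f g Logic.I hf hg.
have [k hk kE] := reflection_lift VB hh.
subst h; exists k; split=> [|k' [hk' k'f k'g]]; first by split.
(* The unit is surjective, so it suffices to compare composites with it; both are mediating
   morphisms out of [P]. *)
apply: quot_alg_ext; apply: hU; split=> //.
exact: namorphism_comp hk' heta.
Qed.

Theorem proposition10p4 (K : fieldType) (I : set (na_polynomial K))
    (A C : naAlgType K) (hA : variety I A) (hC : variety I C) :
  has_coproduct (variety I) A C /\
  is_coproduct (variety I) (P := reflection I (coproduct A C))
    (reflection_unit I (coproduct A C) \o coproduct_inl A C)
    (reflection_unit I (coproduct A C) \o coproduct_inr A C).
Proof.
have cop := reflection_is_coproduct I (coproduct_is_coproduct A C).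
by split=> //; do 3 eexists; apply: cop.
Qed.
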